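(* Let $\kappa<0$, let $(X,\rho)$ be a complete CAT$(\kappa)$ space and let $K\subset X$ be a nonempty closed convex subset. Then $K$ has the fixed point property for nonexpansive mappings (that is, every nonexpansive mapping $T\colon K\to K$ has a fixed point) if and only if $K$ is geodesically bounded.
   Context: For $\kappa<0$, $M_\kappa^2$ denotes the hyperbolic plane $\mathbb{H}^2$ (of constant curvature $-1$) with its distance multiplied by $1/\sqrt{-\kappa}$. A geodesic metric space $X$ is a CAT$(\kappa)$ space if every geodesic triangle $\triangle(x,y,z)$ in $X$ (three points together with metric segments joining them pairwise) satisfies the following: if $\bar\triangle$ is a comparison triangle in $M_\kappa^2$ (a triangle with the same side lengths), then $\rho(a,b)\le d(\bar a,\bar b)$ for all $a,b\in\triangle$, where $\bar a,\bar b\in\bar\triangle$ are the comparison points of $a,b$ and $d$ is the distance of $M_\kappa^2$. In such a space any two points $x,y$ are joined by a unique metric segment $[x,y]$. A subset $K\subset X$ is convex if $[x,y]\subset K$ whenever $x,y\in K$. It is geodesically bounded if it contains no infinite geodesic, i.e. there is no isometric embedding $c\colon[0,\infty)\to X$ with image contained in $K$. A mapping $T\colon K\to K$ is nonexpansive if $\rho(Tx,Ty)\le\rho(x,y)$ for all $x,y\in K$. *)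

(* Defs.v *)
From HB Require Import structures.
From mathcomp Require Import all_boot all_order all_algebra.
From mathcomp Require Import all_classical all_reals all_analysis.

Set Implicit Arguments.
Unset Strict Implicit.
Unset Printing Implicit Defensive.

Import Order.TTheory GRing.Theory Num.Theory.

Local Open Scope classical_set_scope.
Local Open Scope ring_scope.

(* The hyperbolic plane is the upper sheet of the hyperboloid in R^{2,1};      *)
(* coordinate 2 is the time-like one, and cosh d(u,v) = - <u|v>.               *)

Definition minkowski (R : realType) (u v : 'rV[R]_3) : R :=
  u 0 0 * v 0 0 + u 0 1 * v 0 1 - u 0 2 * v 0 2.

Definition hyperbolic_plane (R : realType) : Type :=
  {u : 'rV[R]_3 | (minkowski u u == -1) && (0 < u 0 2)}.

Definition arcosh (R : realType) (t : R) : R := ln (t + Num.sqrt (t ^+ 2 - 1)).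

Definition hyperbolic_dist (R : realType) (u v : hyperbolic_plane R) : R :=
  arcosh (- minkowski (val u) (val v)).

(* Distance of M_kappa^2, for kappa < 0. *)
Definition model_dist (R : realType) (kappa : R) (u v : hyperbolic_plane R) : R :=
  hyperbolic_dist u v / Num.sqrt (- kappa).

(* Segments and triangles are defined over a bare distance function, so that   *)
(* they apply both to [mdist] and to [model_dist kappa].                       *)

(* Only the values of c on [0, d x y] matter; the segment is its image there. *)
Definition metric_segment (R : realType) (T : Type) (d : T -> T -> R)
    (x y : T) (c : R -> T) : Prop :=
  [/\ c 0 = x, c (d x y) = y &
      {in `[0, d x y] &, forall s t, d (c s) (c t) = `|s - t|}].

(* The vertices are p 0, p 1, p 2, and c i is the side from p i to p (i + 1),  *)
(* indices being taken modulo 3.                                               *)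
Definition geodesic_triangle (R : realType) (T : Type) (d : T -> T -> R)
    (p : 'I_3 -> T) (c : 'I_3 -> R -> T) : Prop :=
  forall i, metric_segment d (p i) (p (ordS i)) (c i).

Definition geodesic_space (R : realType) (X : metricType R) : Prop :=
  forall x y : X, exists c, metric_segment mdist x y c.

(* The comparison point of a = c i s is q i s, the point at distance s from    *)
(* the comparison vertex on the corresponding side. A point lying on several   *)
(* sides is compared through each of them.                                     *)
Definition CAT (R : realType) (kappa : R) (X : metricType R) : Prop :=
  geodesic_space X /\
  forall (x : 'I_3 -> X) (c : 'I_3 -> R -> X)
         (p : 'I_3 -> hyperbolic_plane R) (q : 'I_3 -> R -> hyperbolic_plane R),
    geodesic_triangle mdist x c ->
    geodesic_triangle (model_dist kappa) p q ->
    (forall i, model_dist kappa (p i) (p (ordS i)) = mdist (x i) (x (ordS i))) ->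
    forall (i j : 'I_3) (s t : R),
      s \in `[0, mdist (x i) (x (ordS i))] ->
      t \in `[0, mdist (x j) (x (ordS j))] ->
      mdist (c i s) (c j t) <= model_dist kappa (q i s) (q j t).

(* The axiom of [completeType], without its requirement of a base point. *)
Definition complete_space (T : uniformType) : Prop :=
  forall F : set_system T, ProperFilter F -> cauchy F -> exists x : T, F --> x.

Definition geodesically_convex (R : realType) (X : metricType R) (K : set X) :
    Prop :=
  forall (x y : X) (c : R -> X), K x -> K y -> metric_segment mdist x y c ->
    c @` `[0, mdist x y] `<=` K.

Definition geodesic_ray (R : realType) (X : metricType R) (c : R -> X) : Prop :=
  {in `[0, +oo[ &, forall s t, mdist (c s) (c t) = `|s - t|}.

Definition geodesically_bounded (R : realType) (X : metricType R) (K : set X) :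
    Prop :=
  ~ exists2 c : R -> X, geodesic_ray c & c @` `[0, +oo[ `<=` K.

Definition nonexpansive_on (R : realType) (X : metricType R) (K : set X)
    (T : X -> X) : Prop :=
  forall x y, K x -> K y -> mdist (T x) (T y) <= mdist x y.

Definition fixed_point_property (R : realType) (X : metricType R) (K : set X) :
    Prop :=
  forall T : {fun K >-> K}, nonexpansive_on K T -> exists2 x, K x & T x = x.

(* Main.v *)
From HB Require Import structures.
From mathcomp Require Import all_boot all_order all_algebra.
From mathcomp Require Import all_classical all_reals all_analysis.
From mathcomp Require Import ring lra.
Require Import Defs.

(** Write [k] for [Num.sqrt (- kappa)] and measure all lengths in units [1 / k].

    If [K] contains a ray [c], its Busemann function
    [b x = sup_s (s - d(x, c s))] is 1-Lipschitz and satisfies [b (c s) = s].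
    Retracting onto the ray by [b] and then moving one unit forward is a
    nonexpansive self-map of [K] without fixed point
    ([fixed_point_property_bounded]).

    Conversely let [T] be a nonexpansive self-map of [K] without fixed point,
    and fix [x0] in [K]. For [t < 1] the map sending [x] to the point at
    fraction [t] of the segment from [x0] to [T x] is a contraction, hence has a fixed
    point [z t] in [K] ([resolvent_exists]). The curvature assumption enters
    only through the hyperbolic law of cosines ([hinge_comparison]): two
    segments issued from [x0] have an apex defect [D >= 0], one minus the cosine
    of their comparison angle, such that the opposite side of the full hinge
    with legs [a], [b] has hyperbolic cosine exactly
    [cosh (a - b) + sinh a * sinh b * D], and points at distances [a'], [b']
    from [x0] are at most as far apart as the same formula predicts for [a'], [b'].

    Apply this to the segments from [x0] to [T (z t1)] and [T (z t2)], with
    [t1 <= t2], lengths [L1], [L2], and [z t1], [z t2] at distances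
    [r1 = t1 * L1], [r2 = t2 * L2]. Since [T] is nonexpansive, the hinge with
    the longer legs [L1], [L2] has an opposite side no longer than the cut one.
    In negative curvature this forces a small angle: [r1 <= r2]
    ([hinge_shorten_le]) and
    [D * cosh r1 * sinh r2 <= sinh (r2 - r1)] ([hinge_shorten_defect]).
    Both halves of the argument follow from this one estimate.

    - It gives [cosh (d (z t1) (z t2)) <= expR (r2 - r1)]. So if the
      nondecreasing radii [r] stayed bounded as [t] tends to 1, the points [z t]
      would converge, to a fixed point of [T] ([resolvents_unbounded]).

    - It gives [D <= 1 / cosh r1]. So as the radii tend to infinity, the
      initial parts of any given length of the segments from [x0] to [T (z t)]
      converge, and their limits form a ray inside [K]
      ([fixpoint_free_ray]). *)

Set Implicit Arguments.
Unset Strict Implicit.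
Unset Printing Implicit Defensive.

Import Order.TTheory GRing.Theory Num.Theory.
Import numFieldNormedType.Exports.

Local Open Scope classical_set_scope.
Local Open Scope ring_scope.

(** * Hyperbolic functions *)

Section HyperbolicFunctions.
Variable R : realType.
Implicit Types x y a b s t : R.

Definition cosh x : R := (expR x + expR (- x)) / 2.
Definition sinh x : R := (expR x - expR (- x)) / 2.

Lemma cosh0 : cosh 0 = 1.
Proof. by rewrite /cosh oppr0 expR0; field. Qed.

Lemma sinh0 : sinh 0 = 0.
Proof. by rewrite /sinh oppr0 subrr mul0r. Qed.

Lemma coshN x : cosh (- x) = cosh x.
Proof. by rewrite /cosh opprK addrC. Qed.

Lemma sinhN x : sinh (- x) = - sinh x.
Proof. by rewrite /sinh opprK; ring. Qed.

Lemma coshD x y : cosh (x + y) = cosh x * cosh y + sinh x * sinh y.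
Proof. by rewrite /cosh /sinh opprD !expRD; field. Qed.

Lemma sinhD x y : sinh (x + y) = sinh x * cosh y + cosh x * sinh y.
Proof. by rewrite /cosh /sinh opprD !expRD; field. Qed.

Lemma coshB x y : cosh (x - y) = cosh x * cosh y - sinh x * sinh y.
Proof. by rewrite coshD coshN sinhN mulrN. Qed.

Lemma sinhB x y : sinh (x - y) = sinh x * cosh y - cosh x * sinh y.
Proof. by rewrite sinhD coshN sinhN mulrN. Qed.

Lemma cosh2E x : cosh x ^+ 2 = 1 + sinh x ^+ 2.
Proof.
have /eqP : expR x * expR (- x) = 1 by rewrite expRN divff// gt_eqF ?expR_gt0.
rewrite /cosh /sinh -subr_eq0 => /eqP h.
apply/eqP; rewrite -subr_eq0; apply/eqP.
by rewrite -[RHS]h; field.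
Qed.

Lemma cosh_addsinh x : cosh x + sinh x = expR x.
Proof. by rewrite /cosh /sinh; field. Qed.

Lemma cosh_gt0 x : 0 < cosh x.
Proof. by rewrite divr_gt0// addr_gt0// expR_gt0. Qed.

Lemma cosh_ge1 x : 1 <= cosh x.
Proof.
have c0 := cosh_gt0 x; have := cosh2E x; have := sqr_ge0 (sinh x).
by rewrite leNgt => s0 c2; apply/negP => c1; nra.
Qed.

Lemma sinh_ge0 x : 0 <= x -> 0 <= sinh x.
Proof. by move=> x0; rewrite divr_ge0// subr_ge0 ler_expR; lra. Qed.

Lemma sinh_gt0 x : 0 < x -> 0 < sinh x.
Proof. by move=> x0; rewrite divr_gt0// subr_gt0 ltr_expR; lra. Qed.

Lemma ler_sinh x y : x <= y -> sinh x <= sinh y.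
Proof.
by move=> xy; rewrite ler_pM2r// lerB// ler_expR// lerN2.
Qed.

Lemma cosh_half x : cosh x = 1 + 2 * sinh (x / 2) ^+ 2.
Proof.
rewrite [in LHS](_ : x = x / 2 + x / 2); last by field.
by rewrite coshD -!expr2 cosh2E; ring.
Qed.

Lemma ler_cosh x y : 0 <= x -> x <= y -> cosh x <= cosh y.
Proof.
move=> x0 xy; rewrite (cosh_half x) (cosh_half y) lerD2l ler_pM2l//.
by rewrite ler_pXn2r ?nnegrE ?ler_sinh ?sinh_ge0//; lra.
Qed.

Lemma cosh_norm x : cosh `|x| = cosh x.
Proof. by case: ger0P => // _; rewrite coshN. Qed.

Lemma ltr_cosh x y : 0 <= x -> x < y -> cosh x < cosh y.
Proof.
move=> x0 xy; rewrite (cosh_half x) (cosh_half y) ltrD2l ltr_pM2l//.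
rewrite ltr_pXn2r ?nnegrE ?sinh_ge0//; try lra.
by rewrite ltr_pM2r// ltrB// ltr_expR; lra.
Qed.

(** Tangent of the convex function [cosh]. *)
Lemma cosh_tangent x y : cosh x - cosh y <= (x - y) * sinh x.
Proof.
have h1 : expR x * (1 + (y - x)) <= expR y.
  have {2}-> : y = x + (y - x) by ring.
  by rewrite expRD ler_pM2l ?expR_gt0// expR_ge1Dx.
have h2 : expR (- x) * (1 + (x - y)) <= expR (- y).
  have {2}-> : - y = - x + (x - y) by ring.
  by rewrite expRD ler_pM2l ?expR_gt0// expR_ge1Dx.
by rewrite /cosh /sinh; lra.
Qed.

Lemma sinh_MVT x y : x <= y ->
  exists2 z, z \in `[x, y] & sinh y - sinh x = cosh z * (y - x).
Proof.
move=> xy.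
have dsinh (z : R) : is_derive z (1 : R) (sinh : R -> R) (cosh z).
  have -> : (sinh : R -> R) = 2^-1 *: (expR - (expR \o -%R)).
    by apply/funext => u; rewrite /sinh mulrC.
  apply: is_derive_eq.
  by rewrite /cosh /GRing.scale/=; ring.
apply: MVT_segment => //.
apply: continuous_subspaceT => z.
by apply: differentiable_continuous; apply/derivable1_diffP.
Qed.

End HyperbolicFunctions.

(** * Hyperbolic hinges *)

Section HyperbolicInequalities.
Variable R : realType.
Implicit Types x y a b s t : R.

Lemma sinh_tangent x y : 0 <= x -> x <= y ->
  (y - x) * cosh x <= sinh y - sinh x.
Proof.
move=> x0 xy; have [z /itvP zxy ->] := sinh_MVT xy.
rewrite mulrC ler_wpM2r ?subr_ge0// ler_cosh//.
by rewrite zxy.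
Qed.

(** Convexity of [sinh] on the nonnegative half-line, by comparing its mean
    slopes on the two sides of [t * a]. *)
Lemma sinh_scale t a : 0 <= t -> t <= 1 -> 0 <= a ->
  sinh (t * a) <= t * sinh a.
Proof.
move=> t0 t1 a0.
have ta0 : 0 <= t * a by rewrite mulr_ge0.
have taa : t * a <= a by rewrite ler_piMl.
have [z /itvP zi hz] := sinh_MVT ta0.
have hta := sinh_tangent ta0 taa.
have z0 : 0 <= z by rewrite zi.
have hc : cosh z <= cosh (t * a) by rewrite ler_cosh// zi.
rewrite sinh0 !subr0 in hz.
have : 0 <= (1 - t) * (t * a) * (cosh (t * a) - cosh z).
  by rewrite !mulr_ge0 ?subr_ge0.
have : 0 <= t * (sinh a - sinh (t * a) - (a - t * a) * cosh (t * a)).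
  by rewrite mulr_ge0 ?subr_ge0.
by rewrite hz; lra.
Qed.

Lemma cosh_ge_quadratic x : 1 + x ^+ 2 / 2 <= cosh x.
Proof.
wlog x0 : x / 0 <= x => [hw|].
  have [/hw//|/ltW] := leP 0 x.
  by rewrite -oppr_ge0 => /hw; rewrite coshN sqrrN.
have h0 : 0 <= x / 2 by rewrite divr_ge0.
have := sinh_tangent (lexx 0) h0; rewrite cosh0 sinh0 !subr0 mulr1 => h.
by rewrite cosh_half; nra.
Qed.

Lemma cosh_scale t x : 0 <= t -> t <= 1 ->
  cosh (t * x) - 1 <= t ^+ 2 * (cosh x - 1).
Proof.
move=> t0 t1.
rewrite -(cosh_norm (t * x)) -(cosh_norm x) normrM (ger0_norm t0).
have x0 : 0 <= `|x| by [].
move: `|x| x0 => {}x x0.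
rewrite (cosh_half (t * x)) (cosh_half x) -!mulrA.
have x20 : 0 <= x / 2 by rewrite divr_ge0.
have := sinh_scale t0 t1 x20; have : 0 <= sinh (t * (x / 2)).
  by rewrite sinh_ge0// mulr_ge0.
have := sinh_ge0 x20.
move: (sinh _) (sinh _) => v u u0 v0 vu.
have : v ^+ 2 <= (t * u) ^+ 2 by rewrite ler_pXn2r ?nnegrE// mulr_ge0.
by rewrite exprMn; lra.
Qed.

(** The law of cosines: the hyperbolic cosine of the side opposite to the apex
    of a hinge with legs [a], [b], in terms of the apex defect [D], one minus the
    cosine of the angle, so that [D = 0] is the hinge with overlapping legs. *)
Definition hinge D a b := cosh (a - b) + sinh a * sinh b * D.

Lemma hingeC D a b : hinge D a b = hinge D b a.
Proof. by rewrite /hinge -opprB coshN (mulrC (sinh a)). Qed.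

Lemma hinge_ge1 D a b : 0 <= D -> 0 <= a -> 0 <= b -> 1 <= hinge D a b.
Proof.
move=> D0 a0 b0; rewrite (le_trans (cosh_ge1 (a - b)))// lerDl.
by rewrite mulr_ge0// mulr_ge0// sinh_ge0.
Qed.

(** Shrinking both legs of a hinge by [t] shrinks its opposite side. The bound
    is not linear in the length of that side but quadratic in
    [sinh (side / 2)], since [cosh x - 1 = 2 * sinh (x / 2) ^+ 2]; in this form
    it follows term by term from [sinh_scale]. *)
Lemma hinge_scale D a b t : 0 <= D -> 0 <= a -> 0 <= b -> 0 <= t -> t <= 1 ->
  hinge D (t * a) (t * b) - 1 <= t ^+ 2 * (hinge D a b - 1).
Proof.
move=> D0 a0 b0 t0 t1; rewrite /hinge -mulrBr.
have h := cosh_scale (a - b) t0 t1.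
have ha := sinh_scale t0 t1 a0; have hb := sinh_scale t0 t1 b0.
have ta : 0 <= sinh (t * a) by rewrite sinh_ge0// mulr_ge0.
have tb : 0 <= sinh (t * b) by rewrite sinh_ge0// mulr_ge0.
have : sinh (t * a) * sinh (t * b) * D <= (t * sinh a) * (t * sinh b) * D.
  by rewrite ler_wpM2r// ler_pM.
by lra.
Qed.

(** Solving the law of cosines for the angle; the upper bound 2 on the defect is
    the triangle inequality [c <= a + b]. *)
Lemma hinge_exists a b (c : R) :
  0 <= a -> 0 <= b -> `|a - b| <= c -> c <= a + b ->
  exists2 D : R, 0 <= D <= 2 & cosh c = hinge D a b.
Proof.
move=> a0 b0 abc cab; have c0 : 0 <= c := le_trans (normr_ge0 _) abc.
have h1 : cosh (a - b) <= cosh c by rewrite -(cosh_norm (a - b)) ler_cosh.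
have h2 : cosh c <= cosh (a + b) by rewrite ler_cosh.
have [z0|zn0] := eqVneq (sinh a * sinh b) 0.
  (* One leg is 0: then [a - b] and [a + b] agree up to sign. *)
  exists 0; first by rewrite lexx/=.
  apply/eqP; rewrite /hinge mulr0 addr0 eq_le h1 andbT.
  by move: h2; rewrite coshB coshD z0; lra.
have ab0 : 0 < sinh a * sinh b.
  by rewrite lt_neqAle eq_sym zn0/=; apply: mulr_ge0; exact: sinh_ge0.
exists ((cosh c - cosh (a - b)) / (sinh a * sinh b)).
  rewrite ler_pdivrMr// divr_ge0 ?subr_ge0 ?(ltW ab0)//=.
  by move: h2; rewrite coshB coshD; lra.
by rewrite /hinge mulrC divfK//; lra.
Qed.

(** The two estimates that follow compare a hinge with legs [L1], [L2] with the
    hinge at the same apex and legs cut to fractions [t1 <= t2], assuming that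
    the cut hinge has the longer opposite side. *)
Section HingeShortening.
Variables (D t1 t2 L1 L2 : R).
Hypotheses (D0 : 0 <= D) (t10 : 0 < t1) (t12 : t1 <= t2) (t21 : t2 < 1).
Hypotheses (L10 : 0 < L1) (L20 : 0 < L2).
Hypothesis hD : hinge D L1 L2 <= hinge D (t1 * L1) (t2 * L2).
Let r1 := t1 * L1.
Let r2 := t2 * L2.

Let t20 : 0 < t2. Proof. exact: lt_le_trans t12. Qed.
Let t11 : t1 < 1. Proof. exact: le_lt_trans t21. Qed.
Let r10 : 0 < r1. Proof. exact: mulr_gt0. Qed.
Let r20 : 0 < r2. Proof. exact: mulr_gt0. Qed.
Let r1L1 : r1 < L1. Proof. by rewrite gtr_pMl. Qed.
Let r2L2 : r2 < L2. Proof. by rewrite gtr_pMl. Qed.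

(** If [r2 < r1], cutting the legs would strictly decrease the difference of
    their lengths, and it does not increase the defect term. *)
Lemma hinge_shorten_le : r1 <= r2.
Proof.
rewrite leNgt; apply/negP => r21.
have gap : r1 - r2 < L1 - L2.
  rewrite -(@ltr_pM2l _ t1)//; have er1 : r1 = t1 * L1 by [].
  have : t1 * L2 <= r2 by rewrite ler_wpM2r// ltW.
  have : 0 < (1 - t1) * (r1 - r2) by rewrite mulr_gt0// subr_gt0.
  by lra.
have r12 : 0 <= r1 - r2 by rewrite subr_ge0 ltW.
have := ltr_cosh r12 gap.
have : sinh r1 * sinh r2 * D <= sinh L1 * sinh L2 * D.
  by rewrite ler_wpM2r// ler_pM ?sinh_ge0 ?ler_sinh// ltW.
by move: hD; rewrite /hinge -/r1 -/r2; lra.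
Qed.

(** The hypothesis bounds [D * (sinh L1 * sinh L2 - sinh r1 * sinh r2)] by
    [cosh (r2 - r1) - cosh (L2 - L1)]. Tangent lines give a lower bound for the
    first factor and an upper bound for the second, both with the same factor
    [L1 - r1], which cancels; the estimate is thus uniform as the displacement
    [L1 - r1] tends to 0. *)
Lemma hinge_shorten_defect : D * (cosh r1 * sinh r2) <= sinh (r2 - r1).
Proof.
have r12 := hinge_shorten_le.
have Lr10 : 0 < L1 - r1 by rewrite subr_gt0.
have r21 : 0 <= r2 - r1 by rewrite subr_ge0.
have s0 := sinh_ge0 r21.
have num : cosh (r2 - r1) - cosh (L2 - L1) <= (L1 - r1) * sinh (r2 - r1).
  have [h|h] := leP 0 (L2 - L1 - (r2 - r1)).
    have : cosh (r2 - r1) <= cosh (L2 - L1) by rewrite ler_cosh//; lra.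
    have : 0 <= (L1 - r1) * sinh (r2 - r1) by rewrite mulr_ge0// ltW.
    by lra.
  apply: (le_trans (cosh_tangent _ _)); rewrite ler_wpM2r//.
  by have := r2L2; lra.
have den : (L1 - r1) * (cosh r1 * sinh r2) <=
    sinh L1 * sinh L2 - sinh r1 * sinh r2.
  have h1 := sinh_tangent (ltW r10) (ltW r1L1).
  have s2 : 0 < sinh r2 by exact: sinh_gt0.
  have s1 : 0 < sinh L1 by exact: sinh_gt0.
  have : sinh r2 <= sinh L2 by rewrite ler_sinh// ltW.
  by nra.
rewrite -(ler_pM2l Lr10); apply: le_trans num.
have : D * ((L1 - r1) * (cosh r1 * sinh r2)) <=
    D * (sinh L1 * sinh L2 - sinh r1 * sinh r2) by rewrite ler_wpM2l.
move: hD; rewrite /hinge -/r1 -/r2 -(coshN (L1 - L2)) -(coshN (r1 - r2)) !opprB.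
by lra.
Qed.
End HingeShortening.

End HyperbolicInequalities.

(** * The hyperboloid model *)

Section HyperbolicPlane.
Variable R : realType.
Implicit Types (x y a b s t m C S : R) (u v : hyperbolic_plane R).

Lemma arcoshK x : 0 <= x -> arcosh (cosh x) = x.
Proof.
move=> x0; rewrite /arcosh cosh2E [1 + _]addrC addrK.
by rewrite sqrtr_sqr ger0_norm ?sinh_ge0// cosh_addsinh expRK.
Qed.

Lemma cosh_arcosh m : 1 <= m -> cosh (arcosh m) = m.
Proof.
move=> m1; rewrite /arcosh; set q := Num.sqrt _.
have q0 : 0 <= q by exact: sqrtr_ge0.
have q2 : q ^+ 2 = m ^+ 2 - 1 by rewrite sqr_sqrtr// subr_ge0; nra.
have mq : m + q != 0 by apply: lt0r_neq0; lra.
have mq0 : 0 < m + q by lra.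
rewrite /cosh expRN lnK ?posrE//.
have -> : (m + q)^-1 = m - q.
  apply: (mulfI mq); rewrite divff//; nra.
by field.
Qed.

Lemma hyperbolic_plane_norm u : minkowski (val u) (val u) = -1.
Proof. by case: u => u /= /andP[/eqP]. Qed.

Lemma hyperbolic_plane_time u : 0 < val u 0 2.
Proof. by case: u => u /= /andP[_]. Qed.

Definition row3 x y z : 'rV[R]_3 :=
  \row_j (if j == 0 then x else if j == 1 then y else z).

Lemma minkowski_row3 x y z (x' y' z' : R) :
  minkowski (row3 x y z) (row3 x' y' z') = x * x' + y * y' - z * z'.
Proof. by rewrite /minkowski !mxE. Qed.

(** The point at distance [r] from the base point, in the direction of the
    unit vector [(C, S)]. *)
Definition polar_vec C S r := row3 (sinh r * C) (sinh r * S) (cosh r).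

Lemma minkowski_polar C S C' S' r r' :
  minkowski (polar_vec C S r) (polar_vec C' S' r') =
  sinh r * sinh r' * (C * C' + S * S') - cosh r * cosh r'.
Proof. by rewrite minkowski_row3; ring. Qed.

Lemma polar_subproof C S r : C ^+ 2 + S ^+ 2 = 1 ->
  (minkowski (polar_vec C S r) (polar_vec C S r) == -1) &&
  (0 < polar_vec C S r 0 2).
Proof.
move=> CS; rewrite minkowski_polar -!expr2 CS mulr1 cosh2E !mxE/= cosh_gt0 andbT.
by apply/eqP; ring.
Qed.

Definition polar C S (CS : C ^+ 2 + S ^+ 2 = 1) r : hyperbolic_plane R :=
  exist _ (polar_vec C S r) (polar_subproof r CS).

(** The point at distance [s] from [u] on the geodesic from [u] to [v], when [u]
    and [v] are at distance [d]. *)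
Definition geodesic_vec (u v : 'rV[R]_3) d s : 'rV[R]_3 :=
  (sinh d)^-1 *: (sinh (d - s) *: u + sinh s *: v).

Lemma minkowski_geodesic u v d s t : 0 < d ->
  minkowski (val u) (val v) = - cosh d ->
  minkowski (geodesic_vec (val u) (val v) d s)
            (geodesic_vec (val u) (val v) d t) = - cosh (s - t).
Proof.
move=> d0 uv.
have d1 : sinh d != 0 by rewrite gt_eqF// sinh_gt0.
have := hyperbolic_plane_norm u; have := hyperbolic_plane_norm v; move: uv.
rewrite /minkowski !mxE; move: (val u) (val v) => {}u {}v huv hv hu.
transitivity ((sinh d)^-1 ^+ 2 *
  (sinh (d - s) * sinh (d - t) * (u 0 0 * u 0 0 + u 0 1 * u 0 1 - u 0 2 * u 0 2)
   + sinh s * sinh t * (v 0 0 * v 0 0 + v 0 1 * v 0 1 - v 0 2 * v 0 2)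
   + (sinh (d - s) * sinh t + sinh s * sinh (d - t)) *
     (u 0 0 * v 0 0 + u 0 1 * v 0 1 - u 0 2 * v 0 2))); first by ring.
rewrite huv hu hv coshB !sinhB.
apply: (mulfI (expf_neq0 2 d1)); rewrite mulrA -exprMn divff// expr1n mul1r.
have := cosh2E d; move: (cosh d) (sinh d) => c z cz.
transitivity ((c ^+ 2 - 1) * sinh s * sinh t - z ^+ 2 * cosh s * cosh t).
  by ring.
by rewrite cz; ring.
Qed.

Lemma geodesic_vec_subproof u v d s : 0 < d -> 0 <= s -> s <= d ->
  minkowski (val u) (val v) = - cosh d ->
  (minkowski (geodesic_vec (val u) (val v) d s)
             (geodesic_vec (val u) (val v) d s) == -1) &&
  (0 < geodesic_vec (val u) (val v) d s 0 2).
Proof.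
move=> d0 s0 sd uv; rewrite minkowski_geodesic// subrr cosh0 eqxx/=.
rewrite /geodesic_vec !mxE mulr_gt0 ?invr_gt0 ?sinh_gt0//.
have u0 := hyperbolic_plane_time u; have v0 := hyperbolic_plane_time v.
have [s1|s1] := ltP 0 s.
  by apply: ltr_wpDl; [apply: mulr_ge0 => //; [apply: sinh_ge0; lra|exact: ltW]
                      |apply: mulr_gt0 => //; exact: sinh_gt0].
by apply: ltr_pwDl; [apply: mulr_gt0 => //; apply: sinh_gt0; lra
                    |apply: mulr_ge0; [exact: sinh_ge0|exact: ltW]].
Qed.

Section ModelPlane.
Variable kappa : R.
Hypothesis kappa_lt0 : kappa < 0.
Local Notation k := (Num.sqrt (- kappa)).
Let k0 : 0 < k. Proof. by rewrite sqrtr_gt0 oppr_gt0. Qed.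

Lemma model_distE u v d : 0 <= d ->
  minkowski (val u) (val v) = - cosh (k * d) -> model_dist kappa u v = d.
Proof.
move=> d0 uv; rewrite /model_dist /hyperbolic_dist uv opprK arcoshK.
  by rewrite mulrC mulKf// gt_eqF.
by rewrite mulr_ge0// ltW.
Qed.

Lemma model_dist_norm u v d :
  minkowski (val u) (val v) = - cosh (k * d) -> model_dist kappa u v = `|d|.
Proof.
move=> uv; apply: model_distE => //.
by rewrite uv -(cosh_norm (k * d)) normrM (gtr0_norm k0).
Qed.

(** The hypothesis for [d = 0] stands for the equality case of the reverse
    Cauchy-Schwarz inequality; the formula for the geodesic needs [d > 0]. *)
Lemma model_segment u v d : 0 <= d ->
  minkowski (val u) (val v) = - cosh (k * d) -> (d = 0 -> u = v) ->
  exists c, metric_segment (model_dist kappa) u v c.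
Proof.
move=> d0 uv d_eq0; have duv := model_distE d0 uv.
have [dgt0|dle0] := ltP 0 d; last first.
  have d00 : d = 0 by apply/eqP; rewrite eq_le dle0.
  have uvE := d_eq0 d00; exists (fun=> u); rewrite /metric_segment duv d00.
  split=> // s t; rewrite !in_itv/= -!eq_le => /eqP<- /eqP<-.
  by rewrite subrr normr0 {2}uvE duv.
have kd0 : 0 < k * d by exact: mulr_gt0.
(* The combination is shown to lie on the upper sheet for s in [0, d] only,
   the range on which a metric segment is tested; elsewhere [c s] is [u]. *)
pose c (s : R) : hyperbolic_plane R :=
  insubd u (geodesic_vec (val u) (val v) (k * d) (k * s)).
have cE s : 0 <= s -> s <= d ->
    val (c s) = geodesic_vec (val u) (val v) (k * d) (k * s).
  move=> s0 sd; rewrite /c insubdK//; apply: geodesic_vec_subproof => //.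
    by rewrite mulr_ge0// ltW.
  by rewrite ler_pM2l.
have kd1 : sinh (k * d) != 0 by rewrite gt_eqF// sinh_gt0.
exists c; rewrite /metric_segment duv; split.
- apply: val_inj; rewrite cE// ?ltW// /geodesic_vec mulr0 subr0 sinh0 scale0r addr0.
  by rewrite scalerA mulVf// scale1r.
- apply: val_inj; rewrite cE// ?ltW// /geodesic_vec subrr sinh0 scale0r add0r.
  by rewrite scalerA mulVf// scale1r.
move=> s t; rewrite !in_itv/= => /andP[s0 sd] /andP[t0 td].
by apply: model_dist_norm; rewrite !cE// minkowski_geodesic// mulrBr.
Qed.

End ModelPlane.
End HyperbolicPlane.

(** * Comparison of hinges *)

Section HingeComparison.
Variables (R : realType) (kappa : R) (X : metricType R).
Hypothesis kappa_lt0 : kappa < 0.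
Hypothesis X_CAT : CAT kappa X.
Local Notation k := (Num.sqrt (- kappa)).
Let k0 : 0 < k. Proof. by rewrite sqrtr_gt0 oppr_gt0. Qed.

(** The comparison triangle has its apex at the base point of the hyperboloid,
    the first leg along a coordinate axis and the second leg in the direction of
    cosine [1 - D]. Both legs are then explicit polar curves, and the law of
    cosines is the Minkowski product of their points. *)
Lemma hinge_comparison (x y z : X) (c1 c2 : R -> X) :
  metric_segment mdist x y c1 -> metric_segment mdist x z c2 ->
  exists2 D, 0 <= D &
    cosh (k * mdist y z) = hinge D (k * mdist x y) (k * mdist x z) /\
    forall s t, 0 <= s <= mdist x y -> 0 <= t <= mdist x z ->
      cosh (k * mdist (c1 s) (c2 t)) <= hinge D (k * s) (k * t).
Proof.
case: X_CAT => X_geo X_cmp seg1 seg2.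
have [c3 seg3] := X_geo y z.
set a := mdist x y; set b := mdist x z; set c := mdist y z.
have a0 : 0 <= a by exact: mdist_ge0.
have b0 : 0 <= b by exact: mdist_ge0.
have c0 : 0 <= c by exact: mdist_ge0.
have abc : `|a - b| <= c.
  have := metric_triangle x y z; have := metric_triangle x z y.
  rewrite (metric_sym z y) -/a -/b -/c => h1 h2.
  by rewrite ler_norml; apply/andP; split; lra.
have cab : c <= a + b by have := metric_triangle y x z; rewrite (metric_sym y x).
have [D /andP[D0 D2] hD] : exists2 D : R, 0 <= D <= 2 &
    cosh (k * c) = hinge D (k * a) (k * b).
  have kge0 := ltW k0.
  apply: hinge_exists; [exact: mulr_ge0|exact: mulr_ge0| |].
    by rewrite -mulrBr normrM gtr0_norm// ler_pM2l.
  by rewrite -mulrDr ler_pM2l.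
exists D => //; split => //.
have CS : (1 - D) ^+ 2 + Num.sqrt (1 - (1 - D) ^+ 2) ^+ 2 = 1.
  by rewrite sqr_sqrtr; [ring|nra].
have CS0 : (1 : R) ^+ 2 + 0 ^+ 2 = 1 by ring.
pose p0 := polar CS0 0; pose p1 := polar CS0 (k * a); pose p2 := polar CS (k * b).
have p0E : polar CS 0 = p0.
  by apply: val_inj; rewrite /= /polar_vec sinh0 !mul0r.
have ray C S (e : C ^+ 2 + S ^+ 2 = 1) r r' :
    model_dist kappa (polar e (k * r)) (polar e (k * r')) = `|r - r'|.
  apply: model_dist_norm => //.
  by rewrite minkowski_polar -!expr2 e mulr1 mulrBr coshB; ring.
have mink12 s t : minkowski (val (polar CS0 (k * s))) (val (polar CS (k * t))) =
    - hinge D (k * s) (k * t).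
  by rewrite minkowski_polar /hinge coshB; ring.
have p12 : minkowski (val p1) (val p2) = - cosh (k * c) by rewrite mink12 hD.
have [q1 seg_q1] : exists q1, metric_segment (model_dist kappa) p1 p2 q1.
  apply: (model_segment kappa_lt0 c0 p12) => c_eq0.
  have ab : a = b.
    by apply/eqP; rewrite -subr_eq0 -normr_le0 (le_trans abc)// c_eq0.
  have D_eq0 : (k * a = 0) \/ D = 0.
    have [<-|an0] := eqVneq 0 (k * a); first by left.
    right; move: hD; rewrite c_eq0 -ab /hinge mulr0 subrr cosh0.
    have : 0 < sinh (k * a).
      by apply: sinh_gt0; rewrite lt_neqAle an0 mulr_ge0// ltW.
    move=> s0 e; have /eqP : sinh (k * a) * sinh (k * a) * D = 0 by lra.
    by rewrite -mulrA !(@mulrI_eq0 _ (sinh (k * a)))=> [/eqP//||];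
      apply/mulfI/lt0r_neq0.
  rewrite /p2 -ab; apply: val_inj; rewrite /= /polar_vec.
  case: D_eq0 => [->|->]; first by rewrite sinh0 !mul0r.
  by rewrite subr0 expr1n subrr sqrtr0.
have d01 : model_dist kappa p0 p1 = a.
  by have := ray _ _ CS0 0 a; rewrite mulr0 sub0r normrN ger0_norm.
have d12 : model_dist kappa p1 p2 = c by exact: model_distE.
have d20 : model_dist kappa p2 p0 = b.
  by have := ray _ _ CS b 0; rewrite mulr0 p0E subr0 ger0_norm.
move=> s t sa tb.
(* The third side runs from [z] back to [x], hence the reversal [b - r]. *)
pose xs (i : 'I_3) := nth x [:: x; y; z] i.
pose cs (i : 'I_3) := nth c1 [:: c1; c3; fun r => c2 (b - r)] i.
pose ps (i : 'I_3) := nth p0 [:: p0; p1; p2] i.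
pose qs (i : 'I_3) := nth q1
  [:: fun r => polar CS0 (k * r); q1; fun r => polar CS (k * (b - r))] i.
have := X_cmp xs cs ps qs.
have Hx : geodesic_triangle mdist xs cs.
  case=> [[|[|[|//]]] ?]; rewrite /xs /cs /=; first exact: seg1.
    exact: seg3.
  case: seg2 => e1 e2 e3; split; rewrite ?(metric_sym z x) ?subr0 ?subrr//.
  move=> r r'; rewrite !in_itv/= -/b => r0 r0'.
  rewrite e3 ?in_itv/= -/b; last 2 first.
    by lra.
    by lra.
  by rewrite distrC; congr `|_|; ring.
have Hp : geodesic_triangle (model_dist kappa) ps qs.
  case=> [[|[|[|//]]] ?]; rewrite /ps /qs /=; last 2 first.
  - exact: seg_q1.
  - rewrite /metric_segment d20; split; rewrite ?subr0 ?subrr ?mulr0//.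
    by move=> r r' _ _; rewrite ray distrC; congr `|_|; ring.
  - by rewrite /metric_segment d01; split; rewrite ?mulr0// => r r' _ _; exact: ray.
move=> /(_ Hx Hp) cmp.
have /cmp{}cmp : forall i,
    model_dist kappa (ps i) (ps (ordS i)) = mdist (xs i) (xs (ordS i)).
  by case=> [[|[|[|//]]] ?]; rewrite /ps /xs /= ?d01 ?d12 ?d20// metric_sym.
have := cmp 0 (inord 2) s (b - t); rewrite /xs /cs /qs /= !inordK//=.
rewrite (metric_sym z x) -/a -/b !in_itv/= sa.
have -> : 0 <= b - t <= b by lra.
rewrite subKr => /(_ isT isT).
rewrite /model_dist /hyperbolic_dist mink12 opprK ler_pdivlMr// mulrC => h.
have /andP[s0 _] := sa; have /andP[t0 _] := tb.
have kge0 := ltW k0.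
have h1 : 1 <= hinge D (k * s) (k * t).
  by apply: hinge_ge1 => //; exact: mulr_ge0.
rewrite -(cosh_arcosh h1); apply: ler_cosh => //.
by rewrite mulr_ge0// mdist_ge0.
Qed.

End HingeComparison.

(** * Limits in metric spaces *)

Section MetricSpace.
Variables (R : realType) (X : metricType R).
Implicit Types (x y z : X) (u : nat -> X).

Lemma mdist_le_eps x y (C : R) :
  (forall e, 0 < e -> mdist x y <= C * e) -> x = y.
Proof.
move=> h; apply: mdist_positivity; apply/eqP; rewrite eq_le mdist_ge0 andbT.
apply/ler_addgt0Pr => e e0; rewrite add0r.
have C0 : 0 < `|C| + 1 by rewrite ltr_wpDl.
apply: (le_trans (h (e / (`|C| + 1)) _)); first by rewrite divr_gt0.
rewrite mulrCA ler_piMr ?(ltW e0)// ler_pdivrMr// mul1r.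
by have := ler_norm C; lra.
Qed.

Lemma complete_cvg u : complete_space X ->
  (forall e, 0 < e -> exists N, forall n, (N <= n)%N -> mdist (u N) (u n) < e) ->
  exists x, u @ \oo --> x.
Proof.
move=> cX ucauchy; apply: (cX (u @ \oo)).
apply: cauchy_exP => e e0; have [N hN] := ucauchy e e0.
by exists (u N), N => // n /= Nn; rewrite ballEmdist; exact: hN.
Qed.

Lemma cvg_mdist u x : u @ \oo --> x ->
  forall e, 0 < e -> exists N, forall n, (N <= n)%N -> mdist x (u n) < e.
Proof.
move=> /cvg_ballP ux e e0; have [N _ hN] := ux e e0.
by exists N => n /hN /=; rewrite ballEmdist.
Qed.

Lemma geometric_cvg u (M t : R) : complete_space X -> 0 <= t -> t < 1 ->
  (forall n, mdist (u n) (u n.+1) <= M * t ^+ n) -> exists x, u @ \oo --> x.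
Proof.
move=> cX t0 t1 ut; apply: complete_cvg => // e e0.
have M0 : 0 <= M by have := ut 0%N; rewrite expr0 mulr1; apply: le_trans; exact: mdist_ge0.
have t10 : 0 < 1 - t by rewrite subr_gt0.
have dist_le n m : mdist (u n) (u (n + m)%N) <= M * t ^+ n * (1 - t ^+ m) / (1 - t).
  elim: m => [|m IH]; first by rewrite addn0 mdistxx expr0 subrr mulr0 mul0r.
  rewrite (le_trans (metric_triangle _ (u (n + m)%N) _))//.
  have := lerD IH (ut (n + m)%N); rewrite addnS => /le_trans; apply.
  rewrite le_eqVlt; apply/orP; left; apply/eqP.
  by rewrite exprD exprS; field; rewrite gt_eqF.
have M1 : 0 < M + 1 by rewrite ltr_wpDl.
have e'0 : 0 < e * (1 - t) / (M + 1).
  by apply: divr_gt0 => //; exact: mulr_gt0.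
have tN : \forall n \near \oo, `|t ^+ n| < e * (1 - t) / (M + 1).
  apply: cvgr0_norm_lt => //; apply: cvg_expr; by rewrite ger0_norm.
have [N _ hN] := tN; exists N => n Nn; rewrite -(subnKC Nn).
apply: (le_lt_trans (dist_le _ _)).
have tN0 : 0 <= t ^+ N by rewrite exprn_ge0.
have := hN N (leqnn N); rewrite ger0_norm// ltr_pdivlMr// => htN.
rewrite ltr_pdivrMr//; apply: le_lt_trans htN.
have tm : 0 <= t ^+ (n - N) by rewrite exprn_ge0.
have Mt : 0 <= M * t ^+ N by rewrite mulr_ge0.
have : 0 <= M * t ^+ N * t ^+ (n - N) by rewrite mulr_ge0.
by lra.
Qed.

(** Banach's fixed point theorem for maps contracting [cosh (k * d) - 1] by
    [t ^+ 2]. As [cosh x - 1 >= x ^+ 2 / 2], the steps of the Picard iteration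
    are still bounded by a geometric sequence of ratio [t]. *)
Lemma cosh_contraction_fixpoint (k t : R) (K : set X) (F : X -> X) :
  complete_space X -> closed K -> K !=set0 -> 0 < k -> 0 <= t -> t < 1 ->
  (forall x, K x -> K (F x)) ->
  (forall x y, K x -> K y ->
    cosh (k * mdist (F x) (F y)) - 1 <= t ^+ 2 * (cosh (k * mdist x y) - 1)) ->
  exists2 z, K z & F z = z.
Proof.
move=> cX Kcl [x0 Kx0] k0 t0 t1 KF Fc.
pose u n := iter n F x0.
have Ku n : K (u n) by elim: n => //= n; exact: KF.
pose E := cosh (k * mdist (u 0%N) (u 1%N)) - 1.
have E0 : 0 <= E by rewrite subr_ge0 cosh_ge1.
have uE n : cosh (k * mdist (u n) (u n.+1)) - 1 <= (t ^+ n) ^+ 2 * E.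
  elim: n => [|n IH]; first by rewrite expr0 expr1n mul1r.
  apply: (le_trans (Fc _ _ (Ku n) (Ku n.+1))).
  rewrite (exprS t n) exprMn -(mulrA (t ^+ 2)).
  by apply: ler_wpM2l => //; exact: sqr_ge0.
have [z uz] : exists z, u @ \oo --> z.
  apply: (@geometric_cvg u (Num.sqrt (2 * E) / k) t) => // n.
  rewrite mulrAC ler_pdivlMr// mulrC.
  have kd0 : 0 <= k * mdist (u n) (u n.+1) by rewrite mulr_ge0 ?mdist_ge0// ltW.
  have st0 : 0 <= Num.sqrt (2 * E) * t ^+ n.
    by apply: mulr_ge0; [exact: sqrtr_ge0|exact: exprn_ge0].
  rewrite -(@ler_pXn2r _ 2)// (exprMn _ (Num.sqrt _)) sqr_sqrtr ?mulr_ge0//.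
  by have := uE n; have := cosh_ge_quadratic (k * mdist (u n) (u n.+1)); lra.
have Kz : K z by apply: (@closed_cvg _ _ \oo _ u K Kcl _ z uz); exact: nearW.
have Fne x y : K x -> K y -> mdist (F x) (F y) <= mdist x y.
  move=> Kx Ky; rewrite leNgt; apply/negP => h.
  have : cosh (k * mdist x y) < cosh (k * mdist (F x) (F y)).
    by rewrite ltr_cosh ?ltr_pM2l// mulr_ge0 ?mdist_ge0// ltW.
  have := Fc _ _ Kx Ky; have := cosh_ge1 (k * mdist x y).
  have : t ^+ 2 <= 1 by rewrite expr_le1// ltW.
  by nra.
exists z => //; apply/esym/(@mdist_le_eps _ _ 2) => e e0.
have [N hN] := cvg_mdist uz e0.
have h1 := hN N (leqnn N); have h2 := hN N.+1 (leqnSn N).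
rewrite /= in h1 h2.
have := metric_triangle z (u N.+1) (F z); have := Fne _ _ (Ku N) Kz.
by rewrite (metric_sym (u N) z) -/(u N.+1); lra.
Qed.

End MetricSpace.

(** * Translation along a ray *)

Section RayRetraction.
Variables (R : realType) (X : metricType R).
Implicit Types x y : X.

(** The Busemann function of the ray, with the sign that makes it increase along
    the ray; as [s - d(x, c s)] is nondecreasing in [s], the supremum is the
    usual limit at infinity. *)
Definition busemann (c : R -> X) (x : X) : R :=
  sup [set s - mdist x (c s) | s in `[0, +oo[%classic].

Section Busemann.
Variable c : R -> X.
Hypothesis c_ray : geodesic_ray c.

Let cE s t : 0 <= s -> 0 <= t -> mdist (c s) (c t) = `|s - t|.
Proof. by move=> s0 t0; apply: c_ray; rewrite in_itv/= andbT. Qed.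

Let busemann_has_sup x :
  has_sup [set s - mdist x (c s) | s in `[0, +oo[%classic].
Proof.
split; first by exists (0 - mdist x (c 0)), 0 => //=; rewrite in_itv/= lexx.
exists (mdist x (c 0)); move=> y [s /=]; rewrite in_itv/= andbT => s0 <-.
have := metric_triangle (c 0) x (c s).
by rewrite cE// sub0r normrN ger0_norm// (metric_sym (c 0)); lra.
Qed.

Lemma busemann_lipschitz x y : `|busemann c x - busemann c y| <= mdist x y.
Proof.
suff le x' y' : busemann c x' <= busemann c y' + mdist x' y'.
  have := le x y; have := le y x; rewrite (metric_sym y x) => h1 h2.
  by rewrite ler_norml; apply/andP; split; lra.
apply: ge_sup; first by case: (busemann_has_sup x').
move=> _ [s s0 <-].
have : s - mdist y' (c s) <= busemann c y'.
  by apply: ub_le_sup; [case: (busemann_has_sup y')|exists s].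
by have := metric_triangle y' x' (c s); rewrite (metric_sym y' x'); lra.
Qed.

Lemma busemann_ray s : 0 <= s -> busemann c (c s) = s.
Proof.
move=> s0; apply/eqP; rewrite eq_le; apply/andP; split.
  apply: ge_sup; first by case: (busemann_has_sup (c s)).
  move=> y [t /=]; rewrite in_itv/= andbT => t0 <-.
  by rewrite cE// -normrN opprB; have := ler_norm (t - s); lra.
have {1}-> : s = s - mdist (c s) (c s) by rewrite mdistxx subr0.
apply: ub_le_sup; first by case: (busemann_has_sup (c s)).
by exists s => //=; rewrite in_itv/= s0.
Qed.

End Busemann.

(** A fixed point [x = c s] of the map below would satisfy [s = s + 1], because
    [busemann c (c s) = s]. *)
Lemma fixed_point_property_bounded (K : set X) :
  fixed_point_property K -> geodesically_bounded K.
Proof.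
move=> fpp [c c_ray cK].
pose pos x := Num.max 0 (busemann c x).
have pos0 x : 0 <= pos x by rewrite le_max lexx.
pose T x := c (pos x + 1).
have T0 x : 0 <= pos x + 1 by rewrite addr_ge0.
have TK : {homo T : x / K x >-> K x}.
  by move=> x _; apply: cK; exists (pos x + 1); rewrite //= in_itv/= T0.
have [x y _ _|x _ /= Tx] := fpp (mkfun_fun TK).
  rewrite /= /mkfun /T c_ray ?in_itv/= ?andbT//.
  apply: le_trans (busemann_lipschitz c_ray x y).
  rewrite opprD addrACA subrr addr0 /pos.
  move: (busemann c x) (busemann c y) => a b.
  rewrite !maxEle; case: (leP 0 a) => a0; case: (leP 0 b) => b0;
    by rewrite ler_norml; apply/andP; split; case: (ger0P (a - b)); lra.
have := busemann_ray c_ray (T0 x); rewrite -/(T x) [T x]Tx => bx.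
have : pos x = busemann c x by rewrite /pos max_r// bx.
by rewrite bx; lra.
Qed.

End RayRetraction.

(** * Existence of a ray *)

Section FixedPoint.
Variables (R : realType) (kappa : R) (X : metricType R) (K : set X).
Hypotheses (kappa_lt0 : kappa < 0) (X_complete : complete_space X).
Hypotheses (X_CAT : CAT kappa X) (K_closed : closed K).
Hypothesis K_convex : geodesically_convex K.
Variables (T : X -> X) (x0 : X) (gam : X -> R -> X).
Hypotheses (TK : forall x, K x -> K (T x)) (T_ne : nonexpansive_on K T).
Hypothesis Kx0 : K x0.
Hypothesis gamP : forall y, metric_segment mdist x0 y (gam y).
Local Notation k := (Num.sqrt (- kappa)).
Let k0 : 0 < k. Proof. by rewrite sqrtr_gt0 oppr_gt0. Qed.

Let mdist_gam y s : 0 <= s <= mdist x0 y -> mdist x0 (gam y s) = s.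
Proof.
move=> /andP[s0 sy]; have [e0 _ e] := gamP y.
have := e 0 s; rewrite e0 sub0r normrN !in_itv/= lexx s0 sy (mdist_ge0 x0 y).
by rewrite (ger0_norm s0); apply.
Qed.

Let K_gam y s : K y -> 0 <= s <= mdist x0 y -> K (gam y s).
Proof.
move=> Ky sy; apply: (K_convex Kx0 Ky (gamP y)).
by exists s => //=; rewrite in_itv/= sy.
Qed.

(** The contraction factor comes from [hinge_scale] applied to the hinge with
    legs [x0 -- T x] and [x0 -- T y], whose opposite side is at most
    [mdist x y]. *)
Lemma resolvent_exists t : 0 <= t -> t < 1 ->
  exists2 z, K z & gam (T z) (t * mdist x0 (T z)) = z.
Proof.
move=> t0 t1.
have range x : 0 <= t * mdist x0 (T x) <= mdist x0 (T x).
  have := mdist_ge0 x0 (T x) => d0.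
  by rewrite mulr_ge0//= ler_piMl// ltW.
apply: (cosh_contraction_fixpoint X_complete K_closed _ k0 t0 t1).
- by exists x0.
- by move=> x Kx; apply: K_gam (range x); exact: TK.
move=> x y Kx Ky.
have [D D0 [hD hle]] := hinge_comparison kappa_lt0 X_CAT (gamP (T x)) (gamP (T y)).
have := hle _ _ (range x) (range y); rewrite !(mulrCA k t).
have kd w : 0 <= k * mdist x0 w by rewrite mulr_ge0 ?mdist_ge0// ltW.
have := hinge_scale D0 (kd (T x)) (kd (T y)) t0 (ltW t1); rewrite -hD.
have : cosh (k * mdist (T x) (T y)) <= cosh (k * mdist x y).
  apply: ler_cosh; first by rewrite mulr_ge0 ?mdist_ge0// ltW.
  by rewrite ler_pM2l//; exact: T_ne.
have : 0 <= t ^+ 2 by exact: sqr_ge0.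
by nra.
Qed.

Hypothesis T_nofix : forall x, K x -> T x <> x.

Variables (t : nat -> R) (z : nat -> X).
Hypotheses (t_gt0 : forall n, 0 < t n) (t_lt1 : forall n, t n < 1).
Hypothesis t_incr : forall n m, (n <= m)%N -> t n <= t m.
Hypothesis t_cvg : forall e, 0 < e -> exists N, forall n, (N <= n)%N -> 1 - t n < e.
Hypothesis Kz : forall n, K (z n).
Hypothesis z_fix : forall n, gam (T (z n)) (t n * mdist x0 (T (z n))) = z n.

Let L n := k * mdist x0 (T (z n)).
Let r n := k * mdist x0 (z n).

Let z_range n : 0 <= t n * mdist x0 (T (z n)) <= mdist x0 (T (z n)).
Proof.
have d0 := mdist_ge0 x0 (T (z n)).
by rewrite mulr_ge0 ?ler_piMl// ltW.
Qed.

Let mdist_z n : mdist x0 (z n) = t n * mdist x0 (T (z n)).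
Proof. by rewrite -{1}z_fix mdist_gam. Qed.

Let rE n : r n = t n * L n.
Proof. by rewrite /r mdist_z mulrCA. Qed.

(* [L n = 0] would force [z n = x0 = T x0]. *)
Let L_gt0 n : 0 < L n.
Proof.
rewrite mulr_gt0// mdist_gt0; apply/eqP => e.
have d0 : mdist x0 (T (z n)) = 0 by rewrite -e mdistxx.
have zx : z n = x0 by apply/esym/mdist_positivity; rewrite mdist_z d0 mulr0.
by apply: (T_nofix Kx0); rewrite -{1}zx -e.
Qed.

Let r_gt0 n : 0 < r n. Proof. by rewrite rE mulr_gt0. Qed.

(** The opposite side of the hinge with legs [L n], [L m] joins [T (z n)] to
    [T (z m)], so it is at most the distance from [z n] to [z m]: the hypothesis
    of the shortening estimates. *)
Lemma resolvent_hinge n m : (n <= m)%N ->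
  r n <= r m /\
  exists2 D, 0 <= D &
    D * (cosh (r n) * sinh (r m)) <= sinh (r m - r n) /\
    forall a b, 0 <= a <= mdist x0 (T (z n)) -> 0 <= b <= mdist x0 (T (z m)) ->
      cosh (k * mdist (gam (T (z n)) a) (gam (T (z m)) b)) <= hinge D (k * a) (k * b).
Proof.
move=> nm.
have [D D0 [hD hle]] :=
  hinge_comparison kappa_lt0 X_CAT (gamP (T (z n))) (gamP (T (z m))).
have short : hinge D (L n) (L m) <= hinge D (t n * L n) (t m * L m).
  rewrite -hD /L -!(mulrCA k).
  apply: le_trans (hle _ _ (z_range n) (z_range m)); rewrite !z_fix.
  apply: ler_cosh; first by rewrite mulr_ge0 ?mdist_ge0// ltW.
  by rewrite ler_pM2l//; exact: T_ne.
have tnm := t_incr nm.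
rewrite !rE; split; first exact: (hinge_shorten_le D0).
exists D => //; split => //; exact: hinge_shorten_defect.
Qed.

Let small_cosh (x y : X) e : 0 < e ->
  cosh (k * mdist x y) < 1 + (k * e) ^+ 2 / 2 -> mdist x y < e.
Proof.
move=> e0 h; rewrite ltNge; apply/negP => ed.
have := cosh_ge_quadratic (k * mdist x y).
have : (k * e) ^+ 2 <= (k * mdist x y) ^+ 2.
  have ke : k * e <= k * mdist x y by rewrite ler_pM2l.
  have ke0 : 0 <= k * e by rewrite mulr_ge0// ltW.
  by nra.
by lra.
Qed.

(** If the radii were bounded they would converge, being nondecreasing; then
    [cosh (k * d (z n) (z m)) <= expR (r m - r n)] makes [z] a Cauchy sequence,
    and its limit is fixed because [z n] is at distance at most a constant times
    [1 - t n] from [T (z n)]. *)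
Lemma resolvents_unbounded M : exists n, M < r n.
Proof.
apply: contrapT => /forallNP r_le.
have rM n : r n <= M by rewrite leNgt; apply/negP; exact: r_le.
have r_sup : has_sup (range r) by split; [exists (r 0%N), 0%N|exists M => _ [n _ <-]].
have [w zw] : exists w : X, z x @[x --> \oo] --> w.
  apply: (@complete_cvg _ _ _ X_complete) => e e0.
  have ke0 : 0 < (k * e) ^+ 2 / 2 by rewrite divr_gt0// exprn_gt0// mulr_gt0.
  pose A := ln (1 + (k * e) ^+ 2 / 2).
  have A0 : 0 < A by rewrite ln_gt0//; lra.
  have [_ [N _ <-] rN] := sup_adherent A0 r_sup.
  exists N => n Nn; apply: small_cosh => //.
  have [rNn [D D0 [hD hle]]] := resolvent_hinge Nn.
  have krE m : k * (t m * mdist x0 (T (z m))) = r m by rewrite rE mulrCA.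
  have := hle _ _ (z_range N) (z_range n); rewrite !z_fix !krE => /le_lt_trans.
  apply.
  have rA : r n - r N < A.
    have : r n <= sup (range r) by apply: sup_upper_bound => //; exists n.
    by lra.
  have sA : cosh (r n - r N) + sinh (r n - r N) < 1 + (k * e) ^+ 2 / 2.
    by rewrite cosh_addsinh -ltr_ln ?posrE ?expR_gt0 ?expRK//; lra.
  have sc : sinh (r N) <= cosh (r N).
    by rewrite /sinh /cosh; have := expR_gt0 (- r N); lra.
  have : D * (sinh (r N) * sinh (r n)) <= D * (cosh (r N) * sinh (r n)).
    by rewrite ler_wpM2l// ler_wpM2r// sinh_ge0// ltW.
  by move: sA hD; rewrite hingeC /hinge; lra.
have Kw : K w by apply: (@closed_cvg _ _ \oo _ z K K_closed _ w zw); exact: nearW.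
pose B := M / (k * t 0%N).
have dB n : mdist x0 (T (z n)) <= B.
  have kt0 : 0 < k * t 0%N by exact: mulr_gt0.
  rewrite ler_pdivlMr//; apply: le_trans (rM n); rewrite rE /L.
  rewrite [leLHS](_ : _ = t 0%N * (k * mdist x0 (T (z n)))); last by ring.
  by rewrite ler_wpM2r ?t_incr// mulr_ge0 ?mdist_ge0// ltW.
have B0 : 0 <= B by apply: le_trans (dB 0%N); exact: mdist_ge0.
have dzT n : mdist (z n) (T (z n)) <= (1 - t n) * B.
  have [_ e1 e2] := gamP (T (z n)).
  rewrite -{1}z_fix -[X in mdist _ X <= _]e1 e2 ?in_itv/= ?z_range//; last first.
    by rewrite lexx mdist_ge0.
  have t1 : 0 <= 1 - t n by rewrite subr_ge0 ltW.
  rewrite -normrN opprB ger0_norm.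
    rewrite [leLHS](_ : _ = (1 - t n) * mdist x0 (T (z n))); last by ring.
    by rewrite ler_wpM2l.
  by rewrite subr_ge0; have /andP[] := z_range n.
apply: (T_nofix Kw); apply/esym/(@mdist_le_eps _ _ _ _ (2 + B)) => e e0.
have [N1 hN1] := cvg_mdist zw e0; have [N2 hN2] := t_cvg e0.
pose n := maxn N1 N2.
have := hN1 n (leq_maxl _ _); have := hN2 n (leq_maxr _ _) => tn dn.
have := metric_triangle w (z n) (T w); have := metric_triangle (z n) (T (z n)) (T w).
have := T_ne (Kz n) Kw; have := dzT n; rewrite (metric_sym (z n) w).
have : (1 - t n) * B <= e * B by rewrite ler_wpM2r// ltW.
by lra.
Qed.

(** For fixed [s], the points at distance [s] from [x0] on the segments to
    [T (z n)] form a Cauchy sequence, because their mutual distances [d] satisfy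
    [cosh (k * d) <= 1 + sinh (k * s) ^+ 2 / cosh (r n)] and [r n] tends to
    infinity. *)
Lemma fixpoint_free_ray : ~ geodesically_bounded K.
Proof.
have r_big M : exists N, forall n, (N <= n)%N -> M < r n.
  have [N hN] := resolvents_unbounded M; exists N => n Nn.
  by have [h _] := resolvent_hinge Nn; exact: lt_le_trans h.
pose c (s : R) n := gam (T (z n)) s.
have c_range s : 0 <= s -> exists N, forall n, (N <= n)%N ->
    0 <= s <= mdist x0 (T (z n)).
  move=> s0; have [N hN] := r_big (k * s); exists N => n /hN.
  rewrite /r ltr_pM2l// mdist_z s0/= => /ltW /le_trans; apply.
  by have /andP[] := z_range n.
have c_cvg s : exists w : X, 0 <= s -> c s @ \oo --> w.
  have [s0|s0] := leP 0 s; last by exists x0 => h; lra.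
  suff [w cw] : exists w : X, c s @ \oo --> w by exists w.
  apply: (@complete_cvg _ _ _ X_complete) => e e0.
  pose e' := (k * e) ^+ 2 / 2.
  have e'0 : 0 < e' by rewrite divr_gt0// exprn_gt0// mulr_gt0.
  have [N1 hN1] := c_range s s0.
  have [N2 hN2] := r_big (sinh (k * s) ^+ 2 / e').
  pose N := maxn N1 N2.
  have NN1 : (N1 <= N)%N by exact: leq_maxl.
  have NN2 : (N2 <= N)%N by exact: leq_maxr.
  exists N => n Nn; apply: small_cosh => //.
  have [rNn [D D0 [hD hle]]] := resolvent_hinge Nn.
  apply: le_lt_trans (hle _ _ (hN1 _ NN1) (hN1 _ (leq_trans NN1 Nn))) _.
  rewrite /hinge subrr cosh0 ltrD2l -expr2 -/e'.
  have Dc : D * cosh (r N) <= 1.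
    have sn : 0 < sinh (r n) by exact: sinh_gt0.
    rewrite -(ler_pM2r sn) mul1r -mulrA; apply: (le_trans hD).
    by apply: ler_sinh; rewrite gerBl// ltW.
  have := hN2 _ NN2; rewrite ltr_pdivrMr// => h.
  have := cosh_ge_quadratic (r N) => hc.
  have rc : r N < cosh (r N) by nra.
  have [->|Dn0] := eqVneq D 0; first by rewrite mulr0.
  have Dgt0 : 0 < D by rewrite lt_neqAle eq_sym Dn0.
  have : sinh (k * s) ^+ 2 * D < r N * e' * D by rewrite ltr_pM2r.
  have : r N * D < 1 by apply: lt_le_trans Dc; rewrite mulrC ltr_pM2l.
  by nra.
have [w wP] := choice c_cvg.
move=> bounded; apply: bounded; exists w.
  move=> a b; rewrite !in_itv/= !andbT => a0 b0.
  have [Na hNa] := c_range a a0; have [Nb hNb] := c_range b b0.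
  have close e : 0 < e -> exists n,
      [/\ mdist (w a) (c a n) < e, mdist (w b) (c b n) < e &
          mdist (c a n) (c b n) = `|a - b|].
    move=> e0.
    have [N1 hN1] := cvg_mdist (wP a a0) e0.
    have [N2 hN2] := cvg_mdist (wP b b0) e0.
    exists (maxn (maxn Na Nb) (maxn N1 N2)); split.
    - by apply: hN1; rewrite !leq_max leqnn !orbT.
    - by apply: hN2; rewrite !leq_max leqnn !orbT.
    - have [_ _] := gamP (T (z (maxn (maxn Na Nb) (maxn N1 N2)))); apply.
        by rewrite in_itv/=; apply: hNa; rewrite !leq_max leqnn.
      by rewrite in_itv/=; apply: hNb; rewrite !leq_max leqnn !orbT.
  apply/eqP; rewrite eq_le; apply/andP; split; apply/ler_addgt0Pr => e e0;
    have [|n [ha hb <-]] := close (e / 2); rewrite ?divr_gt0//.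
    have := metric_triangle (w a) (c a n) (w b).
    have := metric_triangle (c a n) (c b n) (w b).
    by rewrite (metric_sym (c b n)); lra.
  have := metric_triangle (c a n) (w a) (c b n).
  have := metric_triangle (w a) (w b) (c b n).
  by rewrite (metric_sym (c a n) (w a)); lra.
move=> v [a /=]; rewrite in_itv/= andbT => a0 <-.
have [N hN] := c_range a a0.
apply: (@closed_cvg _ _ \oo _ (c a) K K_closed _ (w a) (wP a a0)).
by exists N => // n /= /hN; apply: K_gam; exact: TK.
Qed.

End FixedPoint.

Lemma bounded_fixed_point_property (R : realType) (kappa : R) (X : metricType R)
    (K : set X) :
  kappa < 0 -> complete_space X -> CAT kappa X -> K !=set0 -> closed K ->
  geodesically_convex K -> geodesically_bounded K -> fixed_point_property K.
Proof.
move=> kappa_lt0 cX X_CAT [x0 Kx0] K_closed K_convex K_bounded T T_ne.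
have TK x : K x -> K (T x) by move=> Kx; exact: funS.
apply: contrapT => nofix.
have T_nofix x : K x -> T x <> x by move=> Kx e; apply: nofix; exists x.
have [gam gamP] := choice (proj1 X_CAT x0).
pose t n : R := n.+1%:R / n.+2%:R.
have tE n : t n = 1 - n.+2%:R^-1.
  by rewrite /t -[n.+1%:R in LHS](addrK 1) natr1 mulrDl divff// mulN1r.
have t_gt0 n : 0 < t n by rewrite divr_gt0.
have t_lt1 n : t n < 1 by rewrite tE ltrBlDr ltrDl invr_gt0.
have t_incr n m : (n <= m)%N -> t n <= t m.
  by move=> nm; rewrite !tE lerD2l lerN2 lef_pV2 ?posrE// ler_nat.
have t_cvg e : 0 < e -> exists N, forall n, (N <= n)%N -> 1 - t n < e.
  move=> e0; exists (Num.bound e^-1) => n Nn.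
  rewrite tE subKr -(invrK e) ltf_pV2 ?posrE ?invr_gt0//.
  apply: (lt_le_trans (archi_boundP _)); first by rewrite invr_ge0 ltW.
  by rewrite ler_nat (leq_trans Nn)// ltnW.
have res n : exists z, K z /\ gam (T z) (t n * mdist x0 (T z)) = z.
  have [z Kz zE] := resolvent_exists kappa_lt0 cX X_CAT K_closed K_convex TK
    T_ne Kx0 gamP (ltW (t_gt0 n)) (t_lt1 n).
  by exists z.
have [z zP] := choice res.
exact: (fixpoint_free_ray kappa_lt0 cX X_CAT K_closed K_convex TK T_ne Kx0 gamP
  T_nofix t_gt0 t_lt1 t_incr t_cvg (fun n => (zP n).1) (fun n => (zP n).2)).
Qed.

Theorem corollary4p3 (R : realType) (kappa : R) (X : metricType R) (K : set X)
    (kappa_lt0 : kappa < 0) (X_complete : complete_space X)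
    (X_CAT : CAT kappa X) (K_neq0 : K !=set0) (K_closed : closed K)
    (K_convex : geodesically_convex K) :
  fixed_point_property K <-> geodesically_bounded K.
Proof.
split; first exact: fixed_point_property_bounded.
exact: (bounded_fixed_point_property kappa_lt0).
Qed.
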